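(* Let $k\geq 0$ be an integer. The class of languages accepted by polynomial-time alternating Turing machines that satisfy the property that on each accepting computation path the number of existential guesses on which the bit is guessed as $1$ is at most $k$ is precisely $\mathrm{coNP}$.
   Context: A polynomial-time alternating Turing machine makes existential guesses and universal guesses, each guess being of a single bit in $\{0,1\}$. Each computation path (a root-to-leaf path of the computation tree) has an individual leaf value, Accept or Reject; an accepting computation path is one whose leaf value is Accept. The machine accepts an input if the root evaluates to Accept when existential nodes are evaluated as ''or'' and universal nodes as ''and'' of their children's values. The property in the claim requires that, for every input, any path along which at least $k+1$ existential guesses have the value $1$ has leaf value Reject. *)

(* Defs.v *)
From mathcomp Require Import all_boot all_algebra.
From mathcomp Require Import classical_sets.

Set Implicit Arguments.
Unset Strict Implicit.
Unset Printing Implicit Defensive.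

(* Two-way infinite tapes. The cells from the scanned one rightwards are
   [from], the cells on its left are [before], nearest first. A cell outside
   both lists is blank, the blank symbol being [None]. *)
Record tape (A : Type) := Tape { before : seq (option A); from : seq (option A) }.

Inductive move := MoveLeft | Stay | MoveRight.

Section Tape.
Variable A : Type.

Definition scanned (t : tape A) : option A := head None (from t).

Definition write (a : option A) (t : tape A) : tape A :=
  Tape (before t) (a :: behead (from t)).

Definition move_head (m : move) (t : tape A) : tape A :=
  match m with
  | MoveLeft => Tape (behead (before t)) (head None (before t) :: from t)
  | Stay => t
  | MoveRight => Tape (scanned t :: before t) (behead (from t))
  end.

Definition blank_tape : tape A := Tape [::] [::].

Definition tape_of (w : seq A) : tape A := Tape [::] (map some w).

End Tape.

Inductive quantifier := Existential | Universal.

Inductive mode :=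
  | Halting of bool (* [true] is Accept, [false] is Reject *)
  | Deterministic
  | Guessing of quantifier.

(* Multitape alternating Turing machines with input alphabet [Sigma]. The
   non-blank tape symbols are the letters of [Sigma] and those of [work].
   The transition function receives the guessed bit, if the state is a guessing
   one, and [None] otherwise; it is not used in halting states. *)
Record atm (Sigma : finType) := Atm {
  state : finType;
  start : state;
  mode_of : state -> mode;
  work : finType;
  tape_index : finType;
  input_tape : tape_index;
  trans : state -> {ffun tape_index -> option (Sigma + work)} -> option bool ->
          state * {ffun tape_index -> option (Sigma + work) * move} }.

(* The bit 1 is [true]. *)
Definition guess := (quantifier * bool)%type.

Definition existential_one (g : guess) : bool :=
  if g is (Existential, true) then true else false.

(* [Branch q t0 t1] is a guess, with subtree [t0] for bit 0, [t1] for bit 1. *)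
Inductive ctree :=
  | Leaf of bool
  | Step of ctree
  | Branch of quantifier & ctree & ctree.

Fixpoint height (t : ctree) : nat :=
  match t with
  | Leaf _ => 0
  | Step t => (height t).+1
  | Branch _ t0 t1 => (maxn (height t0) (height t1)).+1
  end.

Fixpoint value (t : ctree) : bool :=
  match t with
  | Leaf v => v
  | Step t => value t
  | Branch Existential t0 t1 => value t0 || value t1
  | Branch Universal t0 t1 => value t0 && value t1
  end.

(* [path_of t gs v]: some root-to-leaf path of [t] has the sequence of guesses
   [gs] and the leaf value [v]. *)
Inductive path_of : ctree -> seq guess -> bool -> Prop :=
  | PathLeaf v : path_of (Leaf v) [::] v
  | PathStep t gs v : path_of t gs v -> path_of (Step t) gs v
  | PathBranch q t0 t1 (b : bool) gs v :
      path_of (if b then t1 else t0) gs v ->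
      path_of (Branch q t0 t1) ((q, b) :: gs) v.

Section Computation.
Variables (Sigma : finType) (M : atm Sigma).

Definition tapes : Type := {ffun tape_index M -> tape (Sigma + work M)}.

Definition config : Type := (state M * tapes)%type.

Definition init (x : seq Sigma) : config :=
  (start M, [ffun i => if i == input_tape M then tape_of (map inl x)
                       else blank_tape (Sigma + work M)]).

Definition step (c : config) (ob : option bool) : config :=
  let: (q, act) := trans c.1 [ffun i => scanned (c.2 i)] ob in
  (q, [ffun i => move_head (act i).2 (write (act i).1 (c.2 i))]).

(* [computes c t]: the computation from [c] always halts, and its tree is [t]. *)
Inductive computes : config -> ctree -> Prop :=
  | ComputesLeaf c v : mode_of c.1 = Halting v -> computes c (Leaf v)
  | ComputesStep c t :
      mode_of c.1 = Deterministic ->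
      computes (step c None) t -> computes c (Step t)
  | ComputesBranch c q t0 t1 :
      mode_of c.1 = Guessing q ->
      computes (step c (Some false)) t0 -> computes (step c (Some true)) t1 ->
      computes c (Branch q t0 t1).

Definition polynomial_time : Prop :=
  exists p : {poly nat}, forall x : seq Sigma,
    exists2 t, computes (init x) t & height t <= p.[size x]%R.

Definition accepted : set (seq Sigma) :=
  [set x | exists2 t, computes (init x) t & value t = true].

Definition at_most_existential_ones (k : nat) : Prop :=
  forall (x : seq Sigma) t gs,
    computes (init x) t -> path_of t gs true -> count existential_one gs <= k.

Definition nondeterministic : Prop :=
  forall q : state M, mode_of q <> Guessing Universal.

End Computation.

Definition language (Sigma : finType) := set (seq Sigma).

Definition bounded_alternating_P (Sigma : finType) (k : nat) :
    set (language Sigma) :=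
  [set L | exists M : atm Sigma,
     [/\ polynomial_time M, at_most_existential_ones M k & accepted M = L]].

Definition NP (Sigma : finType) : set (language Sigma) :=
  [set L | exists M : atm Sigma,
     [/\ nondeterministic M, polynomial_time M & accepted M = L]].

Definition coNP (Sigma : finType) : set (language Sigma) :=
  [set L | NP (~` L)%classic].

Arguments bounded_alternating_P Sigma k : clear implicits.
Arguments NP Sigma : clear implicits.
Arguments coNP Sigma : clear implicits.

(* Main.v *)
(** If [~` L] is in NP, exchanging the quantifiers and the leaf values of the
    machine gives a machine for [L] without existential guesses.

    Conversely, let [M] be an alternating machine whose accepting paths have at
    most [k] existential ones. A nondeterministic machine verifies that [M]
    rejects by guessing the universal bits and exploring both values of the
    existential bits by depth-first search. A branch with more than [k] ones is
    rejecting and is skipped, so that a tree of height [h] yields a search of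
    length at most [3 * (h + 1) ^ (k + 1)] until its root is reached again.
    Backtracking needs no copy of the tapes: the search pushes each simulated
    step on an additional history tape, and undoes the steps one by one up to
    the last existential one. *)

From HB Require Import structures.
Require Import Defs.
From mathcomp Require Import all_boot all_algebra.
From mathcomp Require Import classical_sets zify.

Set Implicit Arguments.
Unset Strict Implicit.
Unset Printing Implicit Defensive.

(** * Computation trees: paths, uniqueness, and runs with a time bound *)

(** At every branch some child has the value of the node, and following such children leads to a
    leaf with the value of the root. *)
Lemma value_path t : exists gs, path_of t gs (value t).
Proof.
elim: t => [v|t [gs IH]|q t0 [gs0 IH0] t1 [gs1 IH1]] /=.
- by exists [::]; constructor.
- by exists gs; constructor.
- have [b [gs Hgs]] : exists b gs,
      path_of (if b then t1 else t0) gs (value (Branch q t0 t1)).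
    case: q => /=.
    + case E: (value t0) => /=; first by exists false, gs0; rewrite -E.
      by exists true, gs1.
    + case E: (value t0) => /=; first by exists true, gs1.
      by exists false, gs0; rewrite -E.
  by exists ((q, b) :: gs); constructor.
Qed.

Section Computes.
Variables (Sigma : finType) (M : atm Sigma).
Implicit Types (c : config M) (t : ctree).

Lemma computes_inv c t : computes c t ->
  match mode_of c.1 with
  | Halting v => t = Leaf v
  | Deterministic => exists2 t', t = Step t' & computes (step c None) t'
  | Guessing q => exists t0 t1,
      [/\ t = Branch q t0 t1, computes (step c (Some false)) t0
        & computes (step c (Some true)) t1]
  end.
Proof.
by case=> {c t} [c v ->|c t ->|c q t0 t1 -> c0 c1] //; [exists t|exists t0, t1].
Qed.

Lemma computes_inj c t1 t2 : computes c t1 -> computes c t2 -> t1 = t2.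
Proof.
move=> H; elim: H t2 => {c t1} [c v m|c t m _ IH|c q t0 t1 m _ IH0 _ IH1] t2
  /computes_inv; rewrite m => //.
- by move=> [t' -> /IH ->].
- by move=> [t0' [t1' [-> /IH0 -> /IH1 ->]]].
Qed.

Lemma stepE c ob (s := [ffun i => scanned (c.2 i)]) :
  step c ob =
    ((trans c.1 s ob).1,
     [ffun i => move_head ((trans c.1 s ob).2 i).2
                  (write ((trans c.1 s ob).2 i).1 (c.2 i))]).
Proof. by rewrite /step -/s; case: trans. Qed.

Definition runs c (n : nat) (v : bool) : Prop :=
  exists t, [/\ computes c t, height t <= n & value t = v].

Lemma runs_halting c n v : mode_of c.1 = Halting v -> runs c n v.
Proof. by move=> m; exists (Leaf v); split => //; constructor. Qed.

Lemma runs_step c n v : mode_of c.1 = Deterministic ->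
  runs (step c None) n v -> runs c n.+1 v.
Proof. by move=> m [t [ct ht vt]]; exists (Step t); split => //; constructor. Qed.

Lemma runs_guess c n v0 v1 : mode_of c.1 = Guessing Existential ->
  runs (step c (Some false)) n v0 -> runs (step c (Some true)) n v1 ->
  runs c n.+1 (v0 || v1).
Proof.
move=> m [t0 [ct0 ht0 vt0]] [t1 [ct1 ht1 vt1]].
exists (Branch Existential t0 t1); split; first by constructor.
- by rewrite /= ltnS geq_max ht0.
- by rewrite /= vt0 vt1.
Qed.

Lemma runs_leq c m n v : m <= n -> runs c m v -> runs c n v.
Proof.
by move=> mn [t [ct ht vt]]; exists t; split => //; apply: leq_trans mn.
Qed.

End Computes.

(** * Complementation by exchanging quantifiers and leaf values *)

Section Dual.
Variables (Sigma : finType) (M : atm Sigma).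

Definition dual_quantifier q :=
  if q is Existential then Universal else Existential.

Definition dual_mode m :=
  match m with
  | Halting v => Halting (~~ v)
  | Deterministic => Deterministic
  | Guessing q => Guessing (dual_quantifier q)
  end.

Definition dual : atm Sigma :=
  Atm (start M) (fun q => dual_mode (mode_of q)) (input_tape M) (@trans _ M).

Fixpoint dual_tree t :=
  match t with
  | Leaf v => Leaf (~~ v)
  | Step t => Step (dual_tree t)
  | Branch q t0 t1 => Branch (dual_quantifier q) (dual_tree t0) (dual_tree t1)
  end.

Lemma height_dual_tree t : height (dual_tree t) = height t.
Proof. by elim: t => //= [t ->|q t0 -> t1 ->]. Qed.

Lemma value_dual_tree t : value (dual_tree t) = ~~ value t.
Proof.
by elim: t => //= -[] /= t0 -> t1 ->; rewrite ?negb_or ?negb_and.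
Qed.

Lemma computes_dual (c : config M) t :
  computes c t -> computes (M := dual) c (dual_tree t).
Proof.
elim=> {c t} [c v m|c t m _ IH|c q t0 t1 m _ IH0 _ IH1] /=.
- by apply: ComputesLeaf; rewrite /= m.
- by apply: ComputesStep; rewrite //= m.
- by apply: ComputesBranch; rewrite //= m.
Qed.

(** All guesses of [M] are existential, hence all guesses of [dual] are universal. *)
Lemma dual_existential_ones (c : config M) t gs v :
  nondeterministic M -> computes (M := dual) c t -> path_of t gs v ->
  count existential_one gs = 0.
Proof.
move=> ndM H; elim: H gs v => {c t} [c w m|c t m _ IH|c q t0 t1 m _ IH0 _ IH1] gs v H.
- by inversion H.
- by inversion H; subst; apply: IH H1.
- inversion H as [| |q' t0' t1' b gs' v' H']; subst.
  have /negbTE e : ~~ existential_one (q, b).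
    have : dual_mode (@mode_of _ M c.1) = Guessing q := m.
    by have := ndM c.1; case: mode_of => [?||[]] //= _ [<-].
  change (existential_one (q, b) + count existential_one gs' = 0); rewrite e.
  by case: b H' {H e} => H'; [apply: IH1 H'|apply: IH0 H'].
Qed.

End Dual.

(** * Simulating tapes over a larger alphabet and undoing a step *)

Section TapeEmbedding.
Variables (A B : Type) (f : A -> B).

(* Cellwise rather than literal equality, because a tape has several
   representations that differ by trailing blanks. *)
Definition tape_emb (t : tape A) (t' : tape B) : Prop :=
  forall n, nth None (before t') n = omap f (nth None (before t) n) /\
            nth None (from t') n = omap f (nth None (from t) n).

Lemma tape_emb_scanned t t' :
  tape_emb t t' -> scanned t' = omap f (scanned t).
Proof. by move=> e; have [_] := e 0; rewrite !nth0. Qed.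

Lemma tape_emb_write a t t' :
  tape_emb t t' -> tape_emb (write a t) (write (omap f a) t').
Proof.
move=> e n; split; first by have [] := e n.
by case: n => //= n; rewrite !nth_behead; have [] := e n.+1.
Qed.

Lemma tape_emb_move m t t' :
  tape_emb t t' -> tape_emb (move_head m t) (move_head m t').
Proof.
move=> e n; case: m => //=.
- rewrite !nth_behead; split; first by have [] := e n.+1.
  by case: n => [|n] /=; [have [] := e 0; rewrite !nth0|have [] := e n].
- rewrite !nth_behead; split; last by have [] := e n.+1.
  by case: n => [|n] /=; [apply: tape_emb_scanned|have [] := e n].
Qed.

Lemma tape_emb_ext t1 t2 t' :
  (forall n, nth None (before t1) n = nth None (before t2) n /\
             nth None (from t1) n = nth None (from t2) n) ->
  tape_emb t1 t' -> tape_emb t2 t'.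
Proof. by move=> e e1 n; have [<- <-] := e n; apply: e1. Qed.

(** A machine writes on every tape at every step; writing back the scanned symbol is how it leaves a
    tape alone. *)
Lemma tape_emb_rewrite t t' : tape_emb t t' -> tape_emb t (write (scanned t') t').
Proof.
move=> e; rewrite (tape_emb_scanned e).
apply: tape_emb_ext (tape_emb_write _ e) => n; split => //=.
by case: n => [|n] /=; rewrite -?nth0 ?nth_behead.
Qed.

Definition opposite m :=
  match m with
  | MoveLeft => MoveRight
  | Stay => Stay
  | MoveRight => MoveLeft
  end.

(** The overwritten cell is scanned only after moving back, so undoing takes two steps: [Rewind]
    reverses the move and [Restore] writes the old symbol. *)
Lemma tape_emb_undo m a t t' : tape_emb (move_head m (write a t)) t' ->
  tape_emb t (write (omap f (scanned t))
                (move_head (opposite m) (write (scanned t') t'))).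
Proof.
move=> e.
apply: tape_emb_ext
  (tape_emb_write (scanned t) (tape_emb_move (opposite m) (tape_emb_rewrite e))).
by move=> n; split; case: t {e} => [[|b bs] [|x xs]]; case: m; case: n => [|n] //=;
  rewrite ?nth_nil ?nth_behead.
Qed.

End TapeEmbedding.

(** * The nondeterministic machine performing the depth-first search *)

Section Simulator.
Variables (Sigma : finType) (M : atm Sigma) (k : nat).

Notation symbol := (Sigma + work M)%type.
Notation scan := {ffun tape_index M -> option symbol}.

(* A record of one simulated step: the state left, the symbols scanned, the
   guessed bit, and the number of existential ones guessed before. *)
Notation record := (state M * scan * option bool * 'I_k.+1)%type.

Notation symbol' := (Sigma + (work M + record))%type.

(* [Run q j tried]: simulating [q] after [j] existential ones; if [tried] is
   set and [q] guesses existentially, then the bit 1 has been explored. *)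
Inductive sim_state :=
  | Run of state M & 'I_k.+1 & bool
  | Rewind
  | Restore
  | Finished.

Definition sim_code s : (state M * 'I_k.+1 * bool) + option bool :=
  match s with
  | Run q j b => inl (q, j, b)
  | Rewind => inr (Some true)
  | Restore => inr (Some false)
  | Finished => inr None
  end.

Definition sim_decode s : sim_state :=
  match s with
  | inl (q, j, b) => Run q j b
  | inr (Some true) => Rewind
  | inr (Some false) => Restore
  | inr None => Finished
  end.

Lemma sim_codeK : cancel sim_code sim_decode. Proof. by case. Qed.

HB.instance Definition _ := Equality.copy sim_state (can_type sim_codeK).
HB.instance Definition _ := Choice.copy sim_state (can_type sim_codeK).
HB.instance Definition _ := Countable.copy sim_state (can_type sim_codeK).
HB.instance Definition _ := Finite.copy sim_state (can_type sim_codeK).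

Definition emb (s : symbol) : symbol' :=
  match s with inl a => inl a | inr w => inr (inl w) end.

Definition unemb (s : symbol') : option symbol :=
  match s with
  | inl a => Some (inl a)
  | inr (inl w) => Some (inr w)
  | inr (inr _) => None
  end.

Definition emb_record (r : record) : symbol' := inr (inr r).

Definition get_record (s : option symbol') : option record :=
  if s is Some (inr (inr r)) then Some r else None.

(** An accepting leaf refutes the current search at once, whereas a rejecting leaf only triggers
    backtracking. Existential guesses of [M] become deterministic, as both bits are explored in
    turn. *)
Definition sim_mode (s : sim_state) : mode :=
  match s with
  | Run q _ _ =>
      match mode_of q with
      | Halting true => Halting false
      | Guessing Universal => Guessing Existential
      | _ => Deterministic
      end
  | Finished => Halting true
  | _ => Deterministic
  end.

(** Bit 1 is explored before bit 0, and only if [j < k]; hence the counter [inord j.+1] never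
    overflows. *)
Definition sim_bit (q : state M) (j : 'I_k.+1) tried (ob : option bool) : option bool :=
  if mode_of q is Guessing Existential then Some (~~ tried && (j < k)) else ob.

(** Marks the steps at which backtracking stops, bit 0 being still unexplored there. *)
Definition branching (q : state M) (ob : option bool) : bool :=
  if (mode_of q, ob) is (Guessing Existential, Some true) then true else false.

Notation index' := (option (tape_index M)).
Notation action := {ffun index' -> option symbol' * move}.
Implicit Types s : {ffun index' -> option symbol'}.

Definition push_action (r : record) : action :=
  [ffun i => if i is Some i then
      (omap emb ((trans r.1.1.1 r.1.1.2 r.1.2).2 i).1,
       ((trans r.1.1.1 r.1.1.2 r.1.2).2 i).2)
    else (Some (emb_record r), MoveRight)].

Definition retreat_action s : action :=
  [ffun i => (s i, if i is Some _ then Stay else MoveLeft)].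

Definition undo_action (r : record) s : action :=
  [ffun i => (s i, if i is Some i
    then opposite ((trans r.1.1.1 r.1.1.2 r.1.2).2 i).2 else Stay)].

(** After erasing a record, the history head stays on the free cell if the search resumes, and
    otherwise moves to the next record to undo. *)
Definition restore_action (r : record) : action :=
  [ffun i => if i is Some i then (omap emb (r.1.1.2 i), Stay)
    else (None, if branching r.1.1.1 r.1.2 then Stay else MoveLeft)].

Definition sim_trans (st : sim_state) s (ob : option bool) : sim_state * action :=
  match st with
  | Run q j tried =>
      if mode_of q is Halting _ then (Rewind, retreat_action s)
      else
        let ob' := sim_bit q j tried ob in
        let sc : scan := [ffun i => obind unemb (s (Some i))] in
        (Run (trans q sc ob').1 (if branching q ob' then inord j.+1 else j) false,
         push_action (q, sc, ob', j))
  | Rewind =>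
      if get_record (s None) is Some r then (Restore, undo_action r s)
      else (Finished, retreat_action s)
  | Restore =>
      if get_record (s None) is Some r then
        (if branching r.1.1.1 r.1.2 then Run r.1.1.1 r.2 true else Rewind,
         restore_action r)
      else (Finished, retreat_action s)
  | Finished => (Finished, retreat_action s)
  end.

Definition simulator : atm Sigma :=
  @Atm Sigma sim_state (Run (start M) ord0 false) sim_mode
    (work M + record)%type index' (Some (input_tape M)) sim_trans.

Lemma simulator_nondeterministic : nondeterministic simulator.
Proof. by case=> //= q _ _; case: mode_of => // -[]. Qed.

(** A stack whose top is the cell just left of the head. *)
Definition history (h : seq record) : tape record := Tape (map some h) [::].

Definition simulates (c : config M) (H : tape record) (T : tapes simulator) :=
  (forall i, tape_emb emb (c.2 i) (T (Some i))) /\ tape_emb emb_record H (T None).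

Lemma simulates_scan c H T : simulates c H T ->
  [ffun i => obind unemb ([ffun i => scanned (T i)] (Some i))]
    = [ffun i => scanned (c.2 i)] :> scan.
Proof.
case=> e _; apply/ffunP => i; rewrite !ffunE (tape_emb_scanned (e i)).
by case: scanned => [[]|].
Qed.

Lemma simulates_run (c : config M) h T (j : 'I_k.+1) tried ob
    (ob' := sim_bit c.1 j tried ob) :
  simulates c (history h) T -> (forall v, mode_of c.1 <> Halting v) ->
  exists2 T', step (M := simulator) (Run c.1 j tried, T) ob
      = (Run (step c ob').1 (if branching c.1 ob' then inord j.+1 else j) false, T')
    & simulates (step c ob')
        (history ((c.1, [ffun i => scanned (c.2 i)], ob', j) :: h)) T'.
Proof.
move=> S nH; rewrite !stepE /=; set T' := [ffun i => _] : tapes simulator.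
have eT : (sim_trans (Run c.1 j tried) [ffun i => scanned (T i)] ob) =
  (Run (trans c.1 [ffun i => scanned (c.2 i)] ob').1
     (if branching c.1 ob' then inord j.+1 else j) false,
   push_action (c.1, [ffun i => scanned (c.2 i)], ob', j)).
  rewrite /= -/ob'; case E: (mode_of c.1) => [v||q]; first by case: (nH v).
  - by rewrite (simulates_scan S).
  - by rewrite (simulates_scan S).
exists T'; first by rewrite /= in eT; rewrite eT.
rewrite /T' /= in eT *; rewrite eT; split => [i|] /=.
- rewrite !ffunE /=; apply/tape_emb_move/tape_emb_write.
  by case: S.
- by rewrite !ffunE /=; apply: (tape_emb_move MoveRight (tape_emb_write (Some _) S.2)).
Qed.

Lemma simulates_rewind (c : config M) h T ob j
    (r := (c.1, [ffun i => scanned (c.2 i)], ob, j)) n v :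
  simulates (step c ob) (move_head MoveLeft (history (r :: h))) T ->
  (forall T', simulates c
     (if branching c.1 ob then history h else move_head MoveLeft (history h)) T' ->
     runs (M := simulator) (if branching c.1 ob then Run c.1 j true else Rewind, T') n v) ->
  runs (M := simulator) (Rewind, T) n.+2 v.
Proof.
move=> S run; apply: runs_step => //; rewrite stepE /=.
have scT : scanned (T None) = Some (emb_record r).
  by rewrite (tape_emb_scanned S.2).
rewrite !ffunE scT /=; set T1 := [ffun i => _] : tapes simulator.
have T1M i : T1 (Some i) = move_head
    (opposite ((trans c.1 [ffun i => scanned (c.2 i)] ob).2 i).2)
    (write (scanned (T (Some i))) (T (Some i))).
  by rewrite !ffunE.
have T1H : T1 None = write (scanned (T None)) (T None).
  by rewrite !ffunE.
have scT1 : scanned (T1 None) = Some (emb_record r) by rewrite T1H.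
clearbody T1; apply: runs_step => //; rewrite stepE /=.
rewrite !ffunE scT1 /=; apply: run; split => [i|].
- rewrite !ffunE /= T1M.
  have := S.1 i; rewrite stepE /= ffunE => e.
  exact: tape_emb_undo e.
(* With [r] erased, the history tape is [history h] up to trailing blanks. *)
- have e0 : tape_emb emb_record (Tape (map some h) [:: None; None]) (write None (T1 None)).
    apply: (tape_emb_ext (t1 := write None (Tape (map some h) [:: Some r]))).
      by move=> m; split => //; case: m => [|[|m]] //=; rewrite nth_nil.
    by rewrite T1H; apply/(tape_emb_write None)/tape_emb_rewrite/S.2.
  rewrite !ffunE /=.
  case: (branching c.1 ob).
  + by apply: tape_emb_ext e0 => m; split => //; case: m => [|[|m]] //=; rewrite nth_nil.
  + apply: tape_emb_ext (tape_emb_move MoveLeft e0) => m; split => //.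
    by case: m => [|[|[|m]]] //=; rewrite nth_nil.
Qed.

End Simulator.

(** * Recurrences for the length of the search *)

(** The summand 3 pays for one simulated step and the two steps that undo it; [r] stands for the
    number of existential ones still allowed. *)
Lemma expn_bound_step h r : 3 + 3 * h.+1 ^ r.+1 <= 3 * h.+2 ^ r.+1.
Proof.
have : h.+1 ^ r.+1 < h.+2 ^ r.+1 by rewrite ltn_exp2r.
lia.
Qed.

(** Bit 0 keeps the allowance of ones, bit 1 lowers it by one, and 6 pays for making and undoing
    both guesses. Multiply the strict inequality of the powers by [h.+2]. *)
Lemma expn_bound_branch h r :
  6 + 3 * h.+1 ^ r.+2 + 3 * h.+1 ^ r.+1 <= 3 * h.+2 ^ r.+2.
Proof.
have : h.+1 ^ r.+1 < h.+2 ^ r.+1 by rewrite ltn_exp2r.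
rewrite (expnS h.+1 r.+1) (expnS h.+2 r.+1); nia.
Qed.

Lemma expn_bound_mono m n r : m <= n -> 3 * m.+1 ^ r.+1 <= 3 * n.+1 ^ r.+1.
Proof. by move=> mn; rewrite leq_mul2l /= leq_exp2r. Qed.

(** * Outcome and running time of the search *)

Section Correctness.
Variables (Sigma : finType) (M : atm Sigma) (k : nat).

Notation simM := (simulator M k).

(* [v] is the outcome of the pending part of the search, to which the machine
   returns through [Rewind] once [c] has been found rejecting. *)
Lemma simulator_runs (c : config M) t (j : 'I_k.+1) h (T : tapes simM) n v :
  computes c t ->
  (forall gs, path_of t gs true -> j + count existential_one gs <= k) ->
  simulates c (history h) T ->
  (forall T', simulates c (move_head MoveLeft (history h)) T' ->
     runs (M := simM) (Rewind M k, T') n v) ->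
  runs (M := simM) (Run c.1 j false, T)
    (3 * (height t).+1 ^ (k - j).+1 + n) (~~ value t && v).
Proof.
move=> H; elim: H j h T n v => {c t}
  [c w m|c t m _ IH|c q t0 t1 m c0 IH0 c1 IH1] j h T n v ones S run.
- case: w m ones => m ones /=; first by apply: runs_halting; rewrite /= m.
  apply: (@runs_leq _ _ _ n.+1); first by rewrite exp1n; lia.
  apply: runs_step; rewrite /= ?m // stepE /= m.
  apply: run; split => [i|]; rewrite !ffunE.
  + by apply: tape_emb_rewrite; apply: S.1.
  + by apply/(tape_emb_move MoveLeft)/tape_emb_rewrite; apply: S.2.
- have nH w : mode_of c.1 <> Halting w by rewrite m.
  have [T1 E S1] := simulates_run j false None S nH.
  rewrite /sim_bit /branching m in E S1.
  (* The outer successor is the simulated step; [n.+2] adds its undoing to the pending search. *)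
  apply: (@runs_leq _ _ _ (3 * (height t).+1 ^ (k - j).+1 + n.+2).+1).
    by have := expn_bound_step (height t) (k - j) => /=; lia.
  apply: runs_step; rewrite /= ?m // E; apply: IH S1 _.
    by move=> gs p; apply: ones; constructor.
  by move=> T' /simulates_rewind; apply; rewrite /branching m.
- have {}ones b gs : path_of (if b then t1 else t0) gs true ->
      j + (existential_one (q, b) + count existential_one gs) <= k.
    by move=> p; apply: (ones ((q, b) :: gs)); constructor.
  have nH w : mode_of c.1 <> Halting w by rewrite m.
  have {}IH0 h' T0 n' v' := IH0 j h' T0 n' v' (fun gs p =>
    leq_trans (leq_add (leqnn j) (leq_addl _ _)) (ones false gs p)).
  case: q m ones => m ones /=; last first.
    set N := maxn _ _; apply: (@runs_leq _ _ _ (3 * N.+1 ^ (k - j).+1 + n.+2).+1).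
      by have := expn_bound_step N (k - j); lia.
    (* By De Morgan, it suffices that one child rejects; each alternative continues with the same
       pending search. *)
    rewrite negb_and andb_orl; apply: runs_guess; first by rewrite /= m.
    + have [T1 E S1] := simulates_run j false (Some false) S nH.
      rewrite /sim_bit /branching m in E S1; rewrite E.
      apply: (runs_leq (m := 3 * (height t0).+1 ^ (k - j).+1 + n.+2)).
        by rewrite leq_add2r expn_bound_mono // leq_maxl.
      apply: IH0 S1 _.
      by move=> T' /simulates_rewind; apply; rewrite /branching m.
    + have [T1 E S1] := simulates_run j false (Some true) S nH.
      rewrite /sim_bit /branching m in E S1; rewrite E.
      apply: (runs_leq (m := 3 * (height t1).+1 ^ (k - j).+1 + n.+2)).
        by rewrite leq_add2r expn_bound_mono // leq_maxr.
      apply: IH1 S1 _; first by move=> gs p; apply: (ones true).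
      by move=> T' /simulates_rewind; apply; rewrite /branching m.
  (* The exploration of bit 0 is reached in two ways: no further one is allowed, or bit 1 has
     already been explored. *)
  have zero T' tried : ~~ (~~ tried && (j < k)) -> simulates c (history h) T' ->
      runs (M := simM) (Run c.1 j tried, T')
        (3 * (height t0).+1 ^ (k - j).+1 + n.+2).+1 (~~ value t0 && v).
    move=> /negbTE ntried S'.
    have [T1 E S1] := simulates_run j tried None S' nH.
    rewrite /sim_bit /branching m ntried in E S1.
    apply: runs_step; rewrite /= ?m // E; apply: IH0 S1 _.
    by move=> T2 /simulates_rewind; apply; rewrite /branching m.
  set N := maxn _ _; rewrite negb_or.
  have := expn_bound_mono (k - j) (leq_maxl (height t0) (height t1)).
  rewrite -/N => N0; case: (ltnP j k) => jk; last first.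
    (* An accepting path in [t1] would have more than [k] ones, so skipping [t1] is sound. *)
    have -> : value t1 = false.
      have [gs] := value_path t1; case: value => // /(ones true) /=; lia.
    rewrite /= andbT; apply: (runs_leq _ (zero T false _ S)).
      by have := expn_bound_step N (k - j); lia.
    by rewrite /= -leqNgt.
  have j1 : (inord j.+1 : 'I_k.+1) = j.+1 :> nat by rewrite inordK.
  have [T1 E S1] := simulates_run j false None S nH.
  rewrite /sim_bit /branching m /= jk in E S1.
  have r : (k - j).+1 = (k - j.+1).+2 by lia.
  have N1 := expn_bound_mono (k - j.+1) (leq_maxr (height t0) (height t1)).
  (* While bit 1 is explored, the pending search consists of undoing that guess, exploring bit 0,
     and then the former pending search. *)
  apply: (runs_leq (m := (3 * (height t1).+1 ^ (k - j.+1).+1 +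
    (3 * (height t0).+1 ^ (k - j).+1 + n.+2).+3).+1)).
    by rewrite -/N in N1; have := expn_bound_branch N (k - j.+1); rewrite -r; lia.
  apply: runs_step; rewrite /= ?m // E -andbA andbCA.
  move: (inord j.+1 : 'I_k.+1) j1 => j' j1; rewrite -j1; apply: IH1 S1 _.
    by move=> gs p; rewrite j1; have := ones true gs p => /=; lia.
  by move=> T2 /simulates_rewind; apply; rewrite /branching m => T3; apply: zero.
Qed.

Lemma simulator_init x :
  simulates (init M x) (history [::]) (init simM x).2.
Proof.
split => [i|] n; last by rewrite !ffunE /= !nth_nil.
rewrite !ffunE (_ : (Some i == _) = (i == input_tape M)) //.
case: eqP => _; rewrite /= ?nth_nil //; split=> //.
by elim: x n => [|a x IH] [|n] //=.
Qed.

Lemma simulator_rejects x t : at_most_existential_ones M k ->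
  computes (init M x) t ->
  runs (init simM x) (3 * (height t).+1 ^ k.+1 + 1) (~~ value t).
Proof.
move=> ones ct.
(* Nothing is pending at the root: [Rewind] then scans a blank on the history tape and accepts after
   one step. *)
have := simulator_runs (j := ord0) (n := 1) (v := true) ct _ (simulator_init x).
rewrite subn0 andbT; apply => [gs|T' S]; first exact: ones ct.
apply: runs_step => //; rewrite stepE /= !ffunE.
by rewrite (tape_emb_scanned S.2); apply: runs_halting.
Qed.

End Correctness.

(** * The two inclusions *)

Local Open Scope classical_set_scope.

Lemma bounded_alternating_P_coNP (Sigma : finType) k :
  bounded_alternating_P Sigma k `<=` coNP Sigma.
Proof.
move=> L [M [[p time] ones <-]].
have sim x : exists t, computes (init M x) t /\
    runs (init (simulator M k) x) (3 * (p.[size x])%R.+1 ^ k.+1 + 1) (~~ value t).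
  have [t ct ht] := time x; exists t; split => //.
  by apply: runs_leq (simulator_rejects ones ct); rewrite leq_add2r expn_bound_mono.
exists (simulator M k); split; first exact: simulator_nondeterministic.
  (* The search bound with [p] in place of the height; it is a polynomial because [k] is fixed. *)
  exists (3 *: (p + 1) ^+ k.+1 + 1)%R => x.
  have [t [_ [t' [ct' ht' _]]]] := sim x; exists t' => //.
  rewrite (leq_trans ht') //.
  by rewrite !hornerE !ssralg.natrE !addn1.
apply/seteqP; split => x /=; have [t [ct [t' [ct' _ vt']]]] := sim x.
  move=> [t2 /(computes_inj ct') <-]; rewrite vt' => /negP nv.
  by move=> [t3 /(computes_inj ct) <-].
move=> nacc; exists t' => //; rewrite vt'; apply/negP => vt.
by apply: nacc; exists t.
Qed.

Lemma coNP_bounded_alternating_P (Sigma : finType) k :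
  coNP Sigma `<=` bounded_alternating_P Sigma k.
Proof.
move=> L [M [ndM [p time] acc]]; exists (dual M); split.
- exists p => x; have [t ct ht] := time x.
  by exists (dual_tree t); [apply: computes_dual|rewrite height_dual_tree].
- by move=> x t gs ct /(dual_existential_ones ndM ct) ->.
- rewrite -(setCK L) -acc; apply/seteqP; split => x /=; have [t ct _] := time x.
    move=> [t' ct']; rewrite (computes_inj ct' (computes_dual ct)) value_dual_tree.
    by move=> /negP nv [t2 /(computes_inj ct) <-].
  move=> nacc; exists (dual_tree t); first exact: computes_dual.
  by rewrite value_dual_tree; apply/negP => vt; apply: nacc; exists t.
Qed.

Theorem theorem4p3 (Sigma : finType) (k : nat) :
  bounded_alternating_P Sigma k = coNP Sigma.
Proof.
apply/seteqP; split.
- exact: bounded_alternating_P_coNP.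
- exact: coNP_bounded_alternating_P.
Qed.
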